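(* Let $\Sigma$ be a set of identities. Let $\mathcal P$ and $\mathcal Q$ be properties of identities such that $\mathcal Q$ is stronger than $\mathcal P$ (every identity with property $\mathcal Q$ has property $\mathcal P$). Let $D$ be a function which associates with each $\mathcal P$-identity $\mathbf u\approx\mathbf v$ a set $D(\mathbf u\approx\mathbf v)$ so that $D(\mathbf u\approx\mathbf v)$ is empty if and only if $\mathbf u\approx\mathbf v$ is a $\mathcal Q$-identity. Suppose that for each $\mathcal P$-identity $\mathbf u\approx\mathbf v$ which is not a $\mathcal Q$-identity, one can find a $\mathcal P$-identity $\mathbf u_1\approx\mathbf v_1$ such that $\Sigma\vdash\{\mathbf u\approx\mathbf u_1,\ \mathbf v\approx\mathbf v_1\}$ and $|D(\mathbf u_1\approx\mathbf v_1)|<|D(\mathbf u\approx\mathbf v)|$. Then every $\mathcal P$-identity can be derived from $\Sigma$ and from a $\mathcal Q$-identity; that is, for every $\mathcal P$-identity $\tau$ there is a $\mathcal Q$-identity $\tau'$ such that $\Sigma\cup\{\tau'\}\vdash\tau$.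
   Context: Words are elements of the free semigroup $\mathfrak A^+$ over a countable alphabet $\mathfrak A$ of variables; an identity is a formal expression $\mathbf u\approx\mathbf v$ with $\mathbf u,\mathbf v$ words. $\Sigma\vdash\Delta$ means that every identity in $\Delta$ can be derived from identities in $\Sigma$ (equational logic of semigroups). A $\mathcal P$-identity is an identity that has property $\mathcal P$. $|X|$ is the cardinality of the set $X$. *)

(* Defs.v *)
From mathcomp Require Import all_boot.
From mathcomp Require Import boolp classical_sets functions cardinality.

Set Implicit Arguments.
Unset Strict Implicit.
Unset Printing Implicit Defensive.

Local Open Scope classical_set_scope.
Local Open Scope card_scope.

Section Words.
Variable A : countType.

(* The carrier of the free semigroup over A: the empty word is excluded. *)
Definition word := {w : seq A | w != [::]}.

Lemma word_cat_subproof (u v : word) : val u ++ val v != [::].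
Proof. by case: u => [[|x s]]. Qed.

Definition word_cat (u v : word) : word :=
  exist _ (val u ++ val v) (word_cat_subproof u v).

Lemma word_subst_subproof (phi : A -> word) (u : word) :
  flatten [seq val (phi x) | x <- val u] != [::].
Proof. by case: u => [[|x s]] //= _; case: (phi x) => [[|y t]]. Qed.

(* The endomorphism of the free semigroup that extends phi. *)
Definition word_subst (phi : A -> word) (u : word) : word :=
  exist _ (flatten [seq val (phi x) | x <- val u]) (word_subst_subproof phi u).

Record identity := Identity { lhs : word; rhs : word }.

End Words.

Declare Scope identity_scope.
Notation "u ≈ v" := (Identity u v) (at level 70, no associativity)
  : identity_scope.
Open Scope identity_scope.

(* Birkhoff's rules of equational logic, in the signature of semigroups;
   associativity is built into words. *)
Inductive derivable (A : countType) (Sigma : set (identity A)) :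
    identity A -> Prop :=
| derivable_ax tau : Sigma tau -> derivable Sigma tau
| derivable_refl u : derivable Sigma (u ≈ u)
| derivable_sym u v : derivable Sigma (u ≈ v) -> derivable Sigma (v ≈ u)
| derivable_trans u v w :
    derivable Sigma (u ≈ v) -> derivable Sigma (v ≈ w) ->
    derivable Sigma (u ≈ w)
| derivable_cat u v u' v' :
    derivable Sigma (u ≈ v) -> derivable Sigma (u' ≈ v') ->
    derivable Sigma (word_cat u u' ≈ word_cat v v')
| derivable_subst (phi : A -> word A) u v :
    derivable Sigma (u ≈ v) ->
    derivable Sigma (word_subst phi u ≈ word_subst phi v).

Definition derives (A : countType) (Sigma Delta : set (identity A)) : Prop :=
  Delta `<=` derivable Sigma.

Definition card_lt (T U : Type) (X : set T) (Y : set U) : Prop :=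
  X #<= Y /\ ~ (Y #<= X).

(* Main.v *)
(** Cardinals are well-ordered, so among the P-identities whose sides are
    Sigma-equivalent to the respective sides of [tau] one has a defect set [D]
    of least cardinality; by the hypothesis on descent it is a Q-identity,
    and together with Sigma it implies [tau]. *)
Require Import Defs.
From mathcomp Require Import all_boot.
From mathcomp Require Import boolp classical_sets functions cardinality.

Local Open Scope classical_set_scope.

(* Hönig's argument: by Zorn's lemma there is a maximal set S of choice
   functions that pairwise differ at every index. Some projection of S is onto
   X i, for otherwise the missed points form a function that extends S; then
   X i is equipotent to S, which injects into every X j. *)
Lemma card_le_min (I T : Type) (X : I -> set T) :
  inhabited I -> exists i, forall j, (X i #<= X j)%card.
Proof.
move=> [i0].
pose matching (S : set (I -> T)) :=
  (forall f, S f -> forall i, X i (f i)) /\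
  (forall f g, S f -> S g -> forall i, f i = g i -> f = g).
have [|S [[SX Sinj] Smax]] := @Zorn_bigcup _ matching.
  (* Two functions in the union of a chain lie together in the larger of their two members. *)
  move=> F Fm Ftot; split=> [f [S FS Sf]|f g [S FS Sf] [S' FS' S'g] i fgi].
    exact: (Fm S FS).1.
  have [le|le] := Ftot _ _ FS FS'.
    exact: (Fm S' FS').2 (le _ Sf) S'g _ fgi.
  exact: (Fm S FS).2 Sf (le _ S'g) _ fgi.
have proj_card j : ([set f j | f in S] #= S)%card.
  by apply: inj_card_eq => f g /set_mem Sf /set_mem Sg; apply: Sinj.
have [i Xi_sub] : exists i, X i `<=` [set f i | f in S].
  apply: contrapT => /forallNP missed.
  have /choice[h hP] : forall i, exists x, X i x /\ ~ [set f i | f in S] x.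
    by move=> i; have /existsNP[x /not_implyP] := missed i; exists x.
  apply: (Smax (S `|` [set h])).
    split=> [|sub]; first exact: subsetUl.
    (* If [h] were in [S], then [h i0] would be a value at [i0] of a member of [S], which [h]
       avoids. *)
    by apply: (hP i0).2; exists h => //; apply: sub; right.
  split=> [f [/SX//|->] i|f g]; first exact: (hP i).1.
  move=> [Sf|->] [Sg|->] i // fgi; first exact: Sinj fgi.
    by case: (hP i).2; exists f.
  by case: (hP i).2; exists g.
exists i => j; apply: card_le_trans (subset_card_le Xi_sub) _.
rewrite (card_le_eql (proj_card i)) -(card_le_eql (proj_card j)).
by apply: subset_card_le => _ [f Sf <-]; apply: SX.
Qed.

Lemma derivable_sub {A : countType} {Sigma Sigma' : set (identity A)} :
  Sigma `<=` Sigma' -> derivable Sigma `<=` derivable Sigma'.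
Proof.
move=> sub tau; elim=> {tau}.
- by move=> tau /sub; apply: derivable_ax.
- exact: derivable_refl.
- by move=> u v _; apply: derivable_sym.
- by move=> u v w _ + _; apply: derivable_trans.
- by move=> u v u' v' _ + _; apply: derivable_cat.
- by move=> phi u v _; apply: derivable_subst.
Qed.

Theorem lemma3p1 (A : countType) (Sigma : set (identity A))
  (P Q : identity A -> Prop)
  (QP : forall tau : identity A, Q tau -> P tau)
  (T : Type) (D : forall tau : identity A, P tau -> set T)
  (D0 : forall (tau : identity A) (Ptau : P tau),
      D tau Ptau = set0 <-> Q tau)
  (step : forall (u v : word A) (Puv : P (u ≈ v)), ~ Q (u ≈ v) ->
      exists (u1 v1 : word A) (Pu1v1 : P (u1 ≈ v1)),
        derives Sigma [set (u ≈ u1); (v ≈ v1)] /\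
        card_lt (D (u1 ≈ v1) Pu1v1) (D (u ≈ v) Puv)) :
  forall tau : identity A, P tau ->
    exists tau' : identity A,
      Q tau' /\ derives (Sigma `|` [set tau']) [set tau].
Proof.
move=> [u v] Puv.
pose equiv sigma := [/\ P sigma, derivable Sigma (u ≈ lhs sigma)
                              & derivable Sigma (v ≈ rhs sigma)].
(* [D] takes a proof of [P], so the minimum is taken over a sigma type whose elements supply one. *)
have equiv_P (s : {sigma | equiv sigma}) : P (sval s) by case: (svalP s).
have equiv_uv : equiv (u ≈ v) by split=> //; apply: derivable_refl.
have [|[[u' v'] equiv'] minD] :=
    card_le_min {sigma | equiv sigma} T (fun s => D (sval s) (equiv_P s)).
  by apply: inhabits; exists (u ≈ v).
have [_ /= duu' dvv'] := equiv'.
exists (u' ≈ v'); split.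
  apply: contrapT => nQ.
  have [u1 [v1 [P1 [der [_ lt]]]]] := step _ _ (equiv_P (exist _ _ equiv')) nQ.
  have equiv1 : equiv (u1 ≈ v1).
    split=> //=; [apply: derivable_trans duu' _|apply: derivable_trans dvv' _].
      by apply: der; left.
    by apply: der; right.
  apply: lt; have := minD (exist _ _ equiv1).
  (* Minimality and [step] may use different proofs of [P (u1 ≈ v1)]; proof irrelevance identifies
     the two values of [D]. *)
  by rewrite /= (Prop_irrelevance (equiv_P (exist _ _ equiv1)) P1).
(* The chain is [u ≈ u'], [u' ≈ v'], [v' ≈ v]; only the middle link uses the new axiom. *)
move=> _ ->; have sub := derivable_sub (@subsetUl _ Sigma [set (u' ≈ v')]).
apply: derivable_trans (sub _ duu') _.
apply: derivable_trans (derivable_sym (sub _ dvv')).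
by apply: derivable_ax; right.
Qed.
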